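(* Let $(K/D)$ be the Fuxian dichotomy of $\mathbb{Z}_{12}$, $K=\{0,3,4,7,8,9\}$, $D=\{1,2,5,6,10,11\}$, with polarity $p(x)=2+5x$, and let $H_{Fux}\subseteq K\times K$ be the Fuxian three-voice harmonic mask. Then no admitted transition contains a successor $7\to7$ in an active pairwise projection; that is, there are no $\xi,\eta\in K_{H_{Fux}}$ with $\eta\in S_{H_{Fux}}(\xi)$ and $\alpha\in A(\xi)$ such that $\pi_\alpha(\xi)=x+\varepsilon.7$ and $\pi_\alpha(\eta)=y+\varepsilon.7$ for some $x,y\in\mathbb{Z}_{12}$. In particular, proper parallel fifths (such successions $7\to 7$ with $x\neq y$) are excluded in every active pairwise projection.
   Context: **Two-voice notions.** $\mathbb{Z}_{12}[\varepsilon]=\{x+\varepsilon.r:x,r\in\mathbb{Z}_{12}\}$ with $\varepsilon^2=0$ (dual numbers). Put $K[\varepsilon]=\{x+\varepsilon.r:x\in\mathbb{Z}_{12},r\in K\}$ and $D[\varepsilon]=\{x+\varepsilon.r:x\in\mathbb{Z}_{12},r\in D\}$. The affine group $\overrightarrow{GL}(\mathbb{Z}_{12}[\varepsilon])$ consists of the maps $T_s\cdot t:z\mapsto s+tz$ with $s\in\mathbb{Z}_{12}[\varepsilon]$ and $t$ a unit of $\mathbb{Z}_{12}[\varepsilon]$. The Fuxian dichotomy is strong, i.e. there is an affine map of $\mathbb{Z}_{12}$ sending $K$ onto $D$ and only the identity affine map sends $K$ onto $K$; its polarity is the unique affine map $p=T_2\cdot5$ with $p(K)=D$. For $x\in\mathbb{Z}_{12}$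 put $p_x[\varepsilon]=T_{x(1-5)+\varepsilon.2}\cdot5$. For $\zeta=x+\varepsilon.r\in K[\varepsilon]$, $\Omega_K(\zeta)$ is the set of $g\in\overrightarrow{GL}(\mathbb{Z}_{12}[\varepsilon])$ with $\zeta\in gD[\varepsilon]$ and $p_x[\varepsilon](gK[\varepsilon])=gD[\varepsilon]$. Let $m_K(\zeta)=\max_{g\in\Omega_K(\zeta)}|K[\varepsilon]\cap gK[\varepsilon]|$ and $\Sigma_K(\zeta)=\{g\in\Omega_K(\zeta):|K[\varepsilon]\cap gK[\varepsilon]|=m_K(\zeta)\}$. **Three-voice notions.** $\mathbb{Z}_{12}[\varepsilon_1,\varepsilon_2]=\{a+\varepsilon_1.b+\varepsilon_2.c:a,b,c\in\mathbb{Z}_{12}\}$ with $\varepsilon_i\varepsilon_j=0$ for all $i,j\in\{1,2\}$; the element $a+\varepsilon_1.b+\varepsilon_2.c$ is written $\begin{bmatrix} c \\ b \\ a \end{bmatrix}$. The mask is $$H_{Fux}=\left\{\begin{bmatrix} c \\ b \end{bmatrix}\in K\times K \;\middle|\; c-b\notin\{\pm1,\pm2\},\ \text{ and }\ \bigl(c-b\not\equiv0\Rightarrow c-b\not\equiv b\bigr)\right\}$$ (arithmetic in $\mathbb{Z}_{12}$), and $$K_{H_{Fux}}=\left\{\begin{bmatrix} c \\ b \\ a \end{bmatrix}:a\in\mathbb{Z}_{12},\ \begin{bmatrix} c \\ b \end{bmatrix}\in H_{Fux}\right\}.$$ The pairwise projections to $\mathbb{Z}_{12}[\varepsilon]$ are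 $$\pi_{LM}\begin{bmatrix} c \\ b \\ a \end{bmatrix}=a+\varepsilon.b,\quad\pi_{LU}\begin{bmatrix} c \\ b \\ a \end{bmatrix}=a+\varepsilon.c,\quad\pi_{MU}\begin{bmatrix} c \\ b \\ a \end{bmatrix}=(a+b)+\varepsilon.(c-b).$$ For $\xi\in K_{H_{Fux}}$ the active pair set is $A(\xi)=\{\alpha\in\{LM,LU,MU\}:\pi_\alpha(\xi)\in K[\varepsilon]\}$. Put $\Sigma(\xi)=\prod_{\alpha\in A(\xi)}\Sigma_K(\pi_\alpha(\xi))$, and for $\mathbf g=(g_\alpha)_{\alpha\in A(\xi)}\in\Sigma(\xi)$ put $$C(\xi;\mathbf g)=K_{H_{Fux}}\cap\bigcap_{\alpha\in A(\xi)}\pi_\alpha^{-1}(g_\alpha K[\varepsilon]).$$ Let $\Gamma(\xi)$ be the set of $\mathbf g\in\Sigma(\xi)$ for which $|C(\xi;\mathbf g)|$ is maximal over $\Sigma(\xi)$. The admitted-successor set is $S_{H_{Fux}}(\xi)=\bigcup_{\mathbf g\in\Gamma(\xi)}C(\xi;\mathbf g)$, and a transition $\xi\to\eta$ is admitted if and only if $\eta\in S_{H_{Fux}}(\xi)$. *)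

(* Defs.v *)
From HB Require Import structures.
From mathcomp Require Import all_boot all_order all_fingroup all_algebra.

Set Implicit Arguments.
Unset Strict Implicit.
Unset Printing Implicit Defensive.

Import GRing.Theory.
Local Open Scope ring_scope.

(* [Dual x r] is x + eps r with eps ^ 2 = 0; the product is not the
   componentwise one of [R * R], hence the alias. *)
Definition dual (R : Type) : predArgType := (R * R)%type.

Definition Dual (R : Type) (x r : R) : dual R := (x, r).

Section DualRing.

Variable R : finComUnitRingType.

HB.instance Definition _ := Finite.copy (dual R) (R * R)%type.
HB.instance Definition _ := GRing.Zmodule.copy (dual R) (R * R)%type.

Definition dual_one : dual R := Dual 1 0.

Definition dual_mul (z w : dual R) : dual R :=
  Dual (z.1 * w.1) (z.1 * w.2 + z.2 * w.1).

Fact dual_mulA : associative dual_mul.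
Proof.
move=> [a b] [c d] [e f]; congr pair => /=; first by rewrite mulrA.
by rewrite mulrDr mulrDl !mulrA addrA.
Qed.

Fact dual_mulC : commutative dual_mul.
Proof.
move=> [a b] [c d]; congr pair => /=; first by rewrite mulrC.
by rewrite addrC (mulrC a d) (mulrC b c).
Qed.

Fact dual_mul1 : left_id dual_one dual_mul.
Proof. by move=> [a b]; congr pair => /=; rewrite ?mul1r // mul0r addr0. Qed.

Fact dual_mulDl : left_distributive dual_mul +%R.
Proof.
move=> [a b] [c d] [e f]; congr pair => /=; first by rewrite mulrDl.
by rewrite !mulrDl addrACA.
Qed.

Fact dual_one_neq0 : dual_one != 0.
Proof. by apply/eqP=> -[/eqP]; rewrite oner_eq0. Qed.

HB.instance Definition _ := GRing.Zmodule_isComNzRing.Build (dual R)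
  dual_mulA dual_mulC dual_mul1 dual_mulDl dual_one_neq0.

Definition dual_unit : pred (dual R) := fun z => z.1 \is a GRing.unit.

Definition dual_inv (z : dual R) : dual R :=
  if dual_unit z then Dual z.1^-1 (- (z.2 * z.1^-1 * z.1^-1)) else z.

Fact dual_mulV : {in dual_unit, left_inverse 1 dual_inv *%R}.
Proof.
move=> [a b] Ua; rewrite /dual_inv ifT //.
congr pair => /=; first by rewrite mulVr.
by rewrite mulNr mulrVK // mulrC subrr.
Qed.

Fact dual_unitP (z w : dual R) : w * z = 1 -> dual_unit z.
Proof. by move=> [w1z1 _]; apply/unitrPr; exists w.1; rewrite mulrC. Qed.

Fact dual_inv_out : {in [predC dual_unit], dual_inv =1 id}.
Proof. by move=> z Nz; rewrite /dual_inv ifN. Qed.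

HB.instance Definition _ := GRing.ComNzRing_hasMulInverse.Build (dual R)
  dual_mulV dual_unitP dual_inv_out.

Definition dual_scalar (t : {unit R}) : {unit dual R} :=
  FinRing.unit (dual R) (valP t : Dual (val t) 0 \is a GRing.unit).

End DualRing.

(* [(s, t)] stands for the map T_s . t : z |-> s + t z. *)
Definition affine (R : finComUnitRingType) : predArgType := (R * {unit R})%type.

HB.instance Definition _ (R : finComUnitRingType) :=
  Finite.copy (affine R) (R * {unit R})%type.

Definition affine_fun (R : finComUnitRingType) (g : affine R) (z : R) : R :=
  g.1 + val g.2 * z.

Definition Z12e : finComUnitRingType := dual 'Z_12.

Definition K : {set 'Z_12} := [set 0; 3; 4; 7; 8; 9].
Definition D : {set 'Z_12} := [set 1; 2; 5; 6; 10; 11].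

Definition extend (A : {set 'Z_12}) : {set Z12e} :=
  [set z : Z12e | z.2 \in A].

Definition polarity : affine 'Z_12 :=
  (2, FinRing.unit 'Z_12 (isT : (5 : 'Z_12) \is a GRing.unit)).

Lemma K_D_complement : ~: K = D.
Proof.
apply/setP => -[m lt_m]; move: m lt_m.
by do 12?[case=> [|] //]; move=> *; rewrite !inE.
Qed.

Fact K_D_enum (A : {set 'Z_12}) (a : seq nat) (g g0 : affine 'Z_12) :
    (forall x : 'Z_12, (x \in A) = (val x \in a)) ->
    all (fun m => all (fun n => coprime 12 n ==>
          all (fun k => (m + n * k) %% 12 \in a)%N [:: 0; 3; 4; 7; 8; 9]%N ==>
          (m == val g0.1) && (n == val (val g0.2)))
        (iota 0 12)) (iota 0 12) ->
    affine_fun g @: K = A -> g = g0.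
Proof.
move=> Aa /allP chk gKA; case: g gKA => s t gKA.
have /allP/(_ (val (val t))) := chk (val s) ltac:(by rewrite mem_iota ltn_ord).
rewrite mem_iota ltn_ord => /(_ isT); have := valP t; rewrite qualifE /= => ->.
rewrite implyTb => /implyP impl; suff /impl : all (fun k => (val s + val (val t) * k) %% 12 \in a)%N
    [:: 0; 3; 4; 7; 8; 9]%N.
  case/andP=> /eqP/val_inj s0 /eqP/val_inj/val_inj t0.
  by rewrite [g0]surjective_pairing s0 t0.
apply/allP => k Kk; have: affine_fun (s, t) (inZp k) \in A.
  rewrite -gKA imset_f //; move: Kk; rewrite !inE.
  by do 5?[case/predU1P => [->|] //]; move/eqP->.
by rewrite Aa /= modnMmr modnDmr.
Qed.

(* The dichotomy is strong: the polarity is the only affine map sending K onto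
   D, and K has no nontrivial affine symmetry. *)
Lemma K_D_strong :
  (forall g : affine 'Z_12, (affine_fun g @: K == D) = (g == polarity)) /\
  (forall g : affine 'Z_12, (affine_fun g @: K == K) = (g == (0, 1%g))).
Proof.
split=> g; apply/eqP/eqP => [|->].
- apply: (@K_D_enum _ [:: 1; 2; 5; 6; 10; 11]%N) => // x.
  by rewrite !inE -!orbA.
- rewrite !imsetU !imset_set1; apply/setP => -[m lt_m]; move: m lt_m.
  by do 12?[case=> [|] //]; move=> *; rewrite !inE.
- apply: (@K_D_enum _ [:: 0; 3; 4; 7; 8; 9]%N) => // x.
  by rewrite !inE -!orbA.
- rewrite -[RHS]imset_id; apply: eq_imset => x.
  by rewrite /affine_fun /= mul1r add0r.
Qed.

(* T_(x (1 - u) + eps v) . u, where T_v . u = T_2 . 5 is the polarity. *)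
Definition polarity_at (x : 'Z_12) : affine Z12e :=
  (Dual (x * (1 - val polarity.2)) polarity.1, dual_scalar polarity.2).

Definition Omega (zeta : Z12e) : {set affine Z12e} :=
  [set g : affine Z12e |
    (zeta \in affine_fun g @: extend D)
    && (affine_fun (polarity_at zeta.1) @: (affine_fun g @: extend K)
        == affine_fun g @: extend D)].

Definition common (g : affine Z12e) : nat :=
  #|extend K :&: affine_fun g @: extend K|.

Definition max_common (zeta : Z12e) : nat :=
  (\max_(g in Omega zeta) common g)%N.

Definition Sigma (zeta : Z12e) : {set affine Z12e} :=
  [set g in Omega zeta | common g == max_common zeta].

(* The elements a + eps1 b + eps2 c of Z_12[eps1, eps2], as triples (a, b, c).
   Only the underlying set is used: products are always taken in Z_12[eps],
   after projection. *)
Definition Z12e2 : finType := ('Z_12 * 'Z_12 * 'Z_12)%type.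

Definition mask : {set 'Z_12 * 'Z_12} :=
  [set cb : 'Z_12 * 'Z_12 | let: (c, b) := cb in
    [&& c \in K, b \in K, c - b \notin [:: 1; -1; 2; -2] &
        (c - b != 0) ==> (c - b != b)]].

Definition K_mask : {set Z12e2} :=
  [set xi : Z12e2 | let: (a, b, c) := xi in (c, b) \in mask].

(* Pairs among the lower, middle and upper voices. *)
Variant voice_pair : predArgType := LM | LU | MU.

Definition voice_pair_code (p : voice_pair) : option bool :=
  match p with LM => None | LU => Some false | MU => Some true end.

Definition voice_pair_decode (o : option bool) : voice_pair :=
  match o with None => LM | Some false => LU | Some true => MU end.

Fact voice_pair_codeK : cancel voice_pair_code voice_pair_decode.
Proof. by case. Qed.

HB.instance Definition _ := Finite.copy voice_pair (can_type voice_pair_codeK).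

Definition proj (alpha : voice_pair) (xi : Z12e2) : Z12e :=
  let: (a, b, c) := xi in
  match alpha with
  | LM => Dual a b
  | LU => Dual a c
  | MU => Dual (a + b) (c - b)
  end.

Definition active (xi : Z12e2) : {set voice_pair} :=
  [set alpha | proj alpha xi \in extend K].

Definition family_at (xi : Z12e2) : finType :=
  {ffun {alpha | alpha \in active xi} -> affine Z12e}.

Definition Sigma3 (xi : Z12e2) : {set family_at xi} :=
  [set g : family_at xi | [forall alpha, g alpha \in Sigma (proj (val alpha) xi)]].

Definition cell (xi : Z12e2) (g : family_at xi) : {set Z12e2} :=
  K_mask :&: \bigcap_alpha
    (proj (val alpha) @^-1: (affine_fun (g alpha) @: extend K)).

Definition Gamma (xi : Z12e2) : {set family_at xi} :=
  [set g in Sigma3 xi | [forall h in Sigma3 xi, #|cell h| <= #|cell g|]%N].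

Definition successors (xi : Z12e2) : {set Z12e2} :=
  \bigcup_(g in Gamma xi) cell g.

(* Main.v *)
(* The fibres of gK[eps] over Z_12 are translates of a fixed tK, moving
   linearly with the base point. For zeta = x + eps.7, membership of g in Omega
   constrains the fibre over x only: 7 is not in it, and compatibility with the
   polarity determines its offset modulo 3. Among these g, z |-> 7 z shares 60
   points with K[eps], whereas any g having 7 in some fibre shares at most 52; so
   the maximizers never contain y + eps.7. *)
Require Import Defs.
From mathcomp Require Import all_boot all_order all_fingroup all_algebra.
From mathcomp Require Import ring.
Import GRing.Theory.
Local Open Scope ring_scope.

Definition residues : seq 'Z_12 := [seq inZp m | m <- iota 0 12].
Definition K_seq : seq 'Z_12 := [:: 0; 3; 4; 7; 8; 9].
Definition D_seq : seq 'Z_12 := [:: 1; 2; 5; 6; 10; 11].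

Lemma mem_residues (x : 'Z_12) : x \in residues.
Proof. by apply/mapP; exists (val x); rewrite ?mem_iota ?ltn_ord ?valZpK. Qed.

Lemma uniq_residues : uniq residues.
Proof. by vm_compute. Qed.

Lemma residuesP (P : pred 'Z_12) : all P residues -> forall x, P x.
Proof. by move/allP => allP x; apply/allP/mem_residues. Qed.

Lemma mem_K (x : 'Z_12) : (x \in K) = (x \in K_seq).
Proof. by rewrite !inE -!orbA. Qed.

Lemma mem_D (x : 'Z_12) : (x \in D) = (x \in D_seq).
Proof. by rewrite !inE -!orbA. Qed.

Lemma mem_affine_imset (R : finComUnitRingType) (g : affine R) (A : {set R}) z :
  (z \in affine_fun g @: A) = ((val g.2)^-1 * (z - g.1) \in A).
Proof.
have Ug : val g.2 \is a GRing.unit by apply: valP.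
apply/imsetP/idP => [[y Ay ->]|Az]; first by rewrite /affine_fun addrC addKr mulKr.
by exists ((val g.2)^-1 * (z - g.1)); rewrite // /affine_fun mulVKr // addrC subrK.
Qed.

(* For g = T_s . t with t^-1 = v + eps.u, the eps-component of
   t^-1 (x + y + eps.w - s) is v w + u y + offset g x; x serves as the origin
   because the Omega condition at x + eps.r fixes that base point. *)
Definition slope (g : affine Z12e) : Z12e := (val g.2)^-1.

Definition offset (g : affine Z12e) (x : 'Z_12) : 'Z_12 :=
  (slope g).2 * (x - g.1.1) - (slope g).1 * g.1.2.

Lemma mem_extend_imset (g : affine Z12e) (A : {set 'Z_12}) (x y w : 'Z_12) :
  (Dual (x + y) w \in affine_fun g @: extend A) =
  ((slope g).1 * w + (slope g).2 * y + offset g x \in A).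
Proof.
rewrite mem_affine_imset inE /offset /=; congr (_ \in A).
rewrite -/(slope g); case: (slope g) => v u /=.
by rewrite !mulrBr !mulrDr; ring.
Qed.

(** The size of K[eps] meet gK[eps] in coordinates (y, w) centred at a base point, so that it
    depends on three residues only and can be bounded by finite enumeration. *)
Definition overlap (v u e : 'Z_12) : nat :=
  count (fun q => v * q.2 + u * q.1 + e \in K_seq)
    [seq (y, w) | y <- residues, w <- K_seq].

Lemma common_overlap (g : affine Z12e) (x : 'Z_12) :
  common g = overlap (slope g).1 (slope g).2 (offset g x).
Proof.
rewrite /overlap -size_filter; set s := filter _ _.
rewrite -(size_map (fun q => Dual (x + q.1) q.2 : Z12e)).
set t := map _ _; have Ut : uniq t.
  rewrite map_inj_uniq => [|[a b] [c d] e]; last first.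
    by congr pair; [apply: (addrI x); apply: (congr1 fst e) | apply: (congr1 snd e)].
  by rewrite filter_uniq // allpairs_uniq ?uniq_residues // => -[? ?] [].
rewrite -(card_uniqP Ut); apply: eq_card => -[a w]; rewrite inE.
apply/andP/mapP => [[Kw gKz]|[[y k]]]; last first.
  rewrite mem_filter => /andP[gKyk /allpairsP[q [_ Kk ykq]]] ->.
  by rewrite mem_extend_imset mem_K gKyk inE mem_K (congr1 snd ykq : k = q.2).
exists (a - x, w); last by rewrite /= addrC subrK.
rewrite mem_filter allpairs_f ?mem_residues -?mem_K -?mem_extend_imset //.
  by rewrite [x + _]addrC subrK gKz.
by move: Kw; rewrite inE.
Qed.

Lemma overlap_fifth (v u e y : 'Z_12) :
  v * 7 + e \in D_seq ->
  all (fun w => (v * w + e \in K_seq) ==> (v * (2 + 5 * w) + e \in D_seq))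
    residues ->
  v * 7 + u * y + e \in K_seq ->
  (overlap v u e < 60)%N.
Proof.
move=> D7 pol K7.
(* Nested conditionals: under call-by-value, [==>] and [||] evaluate both sides. *)
pose test v e u :=
  if (overlap v u e < 60)%N then true
  else all (fun y => v * 7 + u * y + e \notin K_seq) residues.
(* The conditions on the fibre over the origin involve only [v] and [e], so they prune before [u] is
   enumerated; [y] is tried only where the overlap reaches 60. *)
have: all (fun v => all (fun e =>
    if v * 7 + e \in D_seq then
      if all (fun w => (v * w + e \in K_seq) ==> (v * (2 + 5 * w) + e \in D_seq))
        residues
      then all (test v e) residues else true
    else true) residues) residues by vm_compute.
move/residuesP/(_ v)/residuesP/(_ e); rewrite D7 pol.
move/residuesP/(_ u); rewrite /test; case: ifP => // _ /residuesP/(_ y).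
by rewrite K7.
Qed.

(** Since x(1 - 5) + 5x = x, the induced polarity fixes the base point and acts on its fibre as
    p. *)
Lemma polarity_at_axis (x w : 'Z_12) :
  affine_fun (polarity_at x) (Dual x w) = Dual x (2 + 5 * w).
Proof. by congr pair => /=; ring. Qed.

(** Over the base point itself y = 0, so the [slope] term in eps vanishes and the polarity condition
    becomes one on [v] and [e]. *)
Lemma Omega_axis (g : affine Z12e) (x r : 'Z_12) :
  g \in Omega (Dual x r) ->
  let v := (slope g).1 in let e := offset g x in
  v * r + e \in D_seq /\
  forall w, v * w + e \in K_seq -> v * (2 + 5 * w) + e \in D_seq.
Proof.
have axis A w : (Dual x w \in affine_fun g @: extend A) =
    ((slope g).1 * w + offset g x \in A).
  by have := mem_extend_imset g A x 0 w; rewrite mulr0 !addr0.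
rewrite inE axis mem_D => /andP[Dr /eqP pKD]; split=> // w.
by rewrite -mem_K -mem_D -!axis -pKD -polarity_at_axis; apply: imset_f.
Qed.

(** Serves for 5 and 7, the linear parts of the polarity and of [times7], which both square to 1
    modulo 12. *)
Lemma inv_dual_involution (a : 'Z_12) : a * a = 1 -> (Dual a 0 : Z12e)^-1 = Dual a 0.
Proof.
move=> aa1; have aa : Dual a 0 * Dual a 0 = 1 :> Z12e.
  by congr pair; rewrite /= ?mulr0 ?mul0r ?addr0.
have Ua : (Dual a 0 : Z12e) \is a GRing.unit by apply/unitrPr; exists (Dual a 0).
by rewrite -[LHS]mulr1 -aa mulKr.
Qed.

Definition times7 : affine Z12e :=
  (0, dual_scalar (FinRing.unit 'Z_12 (isT : (7 : 'Z_12) \is a GRing.unit))).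

Lemma slope_times7 : slope times7 = Dual 7 0.
Proof. by apply: inv_dual_involution; apply/val_inj. Qed.

Lemma offset_times7 (x : 'Z_12) : offset times7 x = 0.
Proof. by rewrite /offset slope_times7 /= mul0r mulr0 subr0. Qed.

Lemma mem_times7 (A : {set 'Z_12}) (z : Z12e) :
  (z \in affine_fun times7 @: extend A) = (7 * z.2 \in A).
Proof.
case: z => a w; have := mem_extend_imset times7 A a 0 w.
by rewrite slope_times7 offset_times7 !addr0 /= mul0r addr0.
Qed.

(** 7 * 7 = 1 lies in D, and 7 * 2 = 2 makes multiplication by 7 commute with p. *)
Lemma times7_Omega (x : 'Z_12) : times7 \in Omega (Dual x 7).
Proof.
rewrite inE mem_times7 mem_D; apply/andP; split; first by vm_compute.
apply/eqP/setP => z; rewrite mem_affine_imset inv_dual_involution; last exact/val_inj.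
rewrite !mem_times7 mem_K mem_D /= mul0r addr0; apply/eqP; move: (z.2).
(* Here 5(b - 2) is the preimage of b under p. *)
by apply: (residuesP (fun b => (7 * (5 * (b - 2)) \in K_seq) == (7 * b \in D_seq))); vm_compute.
Qed.

(** Each of the 12 fibres of the image is 7K = {0, 1, 3, 4, 8, 9}, which meets K in five points. *)
Lemma common_times7 : common times7 = 60%N.
Proof. by rewrite (common_overlap times7 0) slope_times7 offset_times7; vm_compute. Qed.

Lemma Sigma_fifth (g : affine Z12e) (x y : 'Z_12) :
  g \in Sigma (Dual x 7) -> Dual y 7 \notin affine_fun g @: extend K.
Proof.
rewrite inE => /andP[Og /eqP maxg]; apply/negP.
rewrite -(subrKC x y) mem_extend_imset mem_K => K7.
have [D7 pol] := Omega_axis _ _ _ Og.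
have := overlap_fifth _ _ _ _ D7 _ K7; rewrite -common_overlap maxg ltnNge.
suff -> : (60 <= max_common (Dual x 7%R))%N.
  by apply/implyP; apply/allP => w _; apply/implyP/pol.
by rewrite -common_times7; apply: leq_bigmax_cond (times7_Omega x).
Qed.

Theorem proposition3p4 :
  (~ exists (xi eta : Z12e2) (alpha : voice_pair),
      [/\ xi \in K_mask, eta \in K_mask, eta \in successors xi &
          alpha \in active xi] /\
      exists x y : 'Z_12,
        proj alpha xi = Dual x 7 /\ proj alpha eta = Dual y 7) /\
  (~ exists (xi eta : Z12e2) (alpha : voice_pair),
      [/\ xi \in K_mask, eta \in K_mask, eta \in successors xi &
          alpha \in active xi] /\
      exists x y : 'Z_12,
        [/\ x <> y, proj alpha xi = Dual x 7 & proj alpha eta = Dual y 7]).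
Proof.
suff no_fifths : ~ exists (xi eta : Z12e2) (alpha : voice_pair),
    [/\ xi \in K_mask, eta \in K_mask, eta \in successors xi &
        alpha \in active xi] /\
    exists x y : 'Z_12, proj alpha xi = Dual x 7 /\ proj alpha eta = Dual y 7.
  split=> // -[xi [eta [alpha [adm [x [y [_ xi7 eta7]]]]]]].
  by apply: no_fifths; exists xi, eta, alpha; split=> //; exists x, y.
move=> [xi [eta [alpha [[_ _ /bigcupP[g Gg] cell_eta act] [x [y [xi7 eta7]]]]]]].
(* The component of [g] at the active pair [alpha] lies in [Sigma], and the cell of [g] projects
   into its image of K[eps]. *)
move: Gg; rewrite inE => /andP[]; rewrite inE => /forallP/(_ (Sub alpha act)).
rewrite SubK xi7 => /(Sigma_fifth _ _ y)/negP[]; rewrite -eta7.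
by move: cell_eta; rewrite inE => /andP[_ /bigcapP/(_ (Sub alpha act) isT)]; rewrite inE.
Qed.
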